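(* Let $(C,\phi)$ be a multistate monotone system with component state sets $\mathcal{S}_i=\{0,1,\ldots,m_i\}$, $m_i\ge1$, and $k\in\{1,\ldots,M\}$. Define the binary monotone system $(C,\psi_k)$ by $\psi_k(\bm{z})=\phi_k(\bm{m}-\bm{1}+\bm{z})$ for $\bm{z}\in\{0,1\}^n$. Then $d(\phi_k)=d(\psi_k)$.
   Context: A multistate monotone system (MMS) $(C,\phi)$ has component set $C=\{1,\ldots,n\}$, component state sets $\mathcal{S}_i=\{0,1,\ldots,m_i\}$, component state space $\mathfrak{C}=\mathcal{S}_1\times\cdots\times\mathcal{S}_n$, system state set $\{0,1,\ldots,M\}$, and a structure function $\phi:\mathfrak{C}\to\{0,\ldots,M\}$ non-decreasing in each argument; $\phi_k(\bm{x})=\mathrm{I}(\phi(\bm{x})\ge k)$; $\bm{m}=(m_1,\ldots,m_n)$, $\bm{1}=(1,\ldots,1)$. Vectors are ordered componentwise. For a binary-valued non-decreasing function $f$ on such a state space, a minimal path vector is $\bm{x}$ with $f(\bm{x})=1$ and $f(\bm{y})=0$ for all $\bm{y}\le\bm{x}$, $\bm{y}\ne\bm{x}$; with $\mathfrak{P}$ the set of these, $\mathrm{cl}(\mathfrak{P})$ is the smallest set containing $\mathfrak{P}$ closed under componentwise maximum. A formation of $\bm{x}\in\mathrm{cl}(\mathfrak{P})$ is a nonempty subset $\{\bm{x}_{i_1},\ldots,\bm{x}_{i_j}\}\subseteq\mathfrak{P}$ whose componentwise maximum is $\bm{x}$, odd/even according to parity of $j$. The signed domination function is $\delta(\bm{x})=$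 (number of odd formations) $-$ (number of even formations) on $\mathrm{cl}(\mathfrak{P})$ and $0$ elsewhere, and the signed domination $d(f)$ is $\delta$ evaluated at the maximal state vector (here $\bm{m}$ for $\phi_k$, and $\bm{1}$ for the binary $\psi_k$, whose component state sets are all $\{0,1\}$). *)

(* Defs.v *)
From mathcomp Require Import all_boot all_order all_algebra.

Set Implicit Arguments.
Unset Strict Implicit.
Unset Printing Implicit Defensive.

(* Component i has state set {0, ..., m i}. *)
Notation state m := {dffun forall i, 'I_(m i).+1}.

Section States.

Variables (n : nat) (m : 'I_n -> nat).
Implicit Types (x y : state m) (S : {set state m}).

Definition state_le x y := [forall i, x i <= y i].

Definition state_bot : state m := [ffun i => ord0].

Definition state_top : state m := [ffun i => ord_max].

Definition state_max x y : state m := [ffun i => Order.max (x i) (y i)].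

(* For nonempty S, the index state_bot is neutral and this is the
   componentwise maximum of S. *)
Definition set_max S : state m := \big[state_max/state_bot]_(x in S) x.

Definition max_closed S :=
  [forall x in S, forall y in S, state_max x y \in S].

Definition nondecreasing (T : Type) (leT : rel T) (f : state m -> T) : Prop :=
  forall x y, state_le x y -> leT (f x) (f y).

Variable f : state m -> bool.

Definition min_path x :=
  f x && [forall y, state_le y x && (y != x) ==> ~~ f y].

Definition min_paths : {set state m} := [set x | min_path x].

Definition min_paths_cl : {set state m} :=
  \bigcap_(S : {set state m} | (min_paths \subset S) && max_closed S) S.

Definition formations x : {set {set state m}} :=
  [set F : {set state m} |
    [&& F != set0, F \subset min_paths & set_max F == x]].

Definition odd_formations x := [set F in formations x | odd #|F|].

Definition even_formations x := [set F in formations x | ~~ odd #|F|].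

Definition signed_domination_fun x : int :=
  if x \in min_paths_cl
  then (#|odd_formations x|%:Z - #|even_formations x|%:Z)%R
  else 0%R.

Definition signed_domination : int := signed_domination_fun state_top.

End States.

Section System.

Variables (n : nat) (m : 'I_n -> nat) (M : nat) (phi : state m -> 'I_M.+1).

Definition structure_level (k : nat) (x : state m) : bool := k <= phi x.

Definition bin_state := state (fun _ : 'I_n => 1).

(* The state m - 1 + z.  When every m i is positive, the value given to inord
   is at most m i; see val_top_shift. *)
Definition top_shift (z : bin_state) : state m :=
  [ffun i => inord (m i - 1 + z i)].

Definition bin_structure (k : nat) (z : bin_state) : bool :=
  structure_level k (top_shift z).

Lemma val_top_shift (z : bin_state) (i : 'I_n) :
  0 < m i -> top_shift z i = m i - 1 + z i :> nat.
Proof.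
move=> mi_gt0; rewrite ffunE inordK // ltnS -{2}(subnK mi_gt0) leq_add2l.
by rewrite -ltnS ltn_ord.
Qed.

Lemma structure_level_nondecreasing (k : nat) :
  nondecreasing (fun a b : 'I_M.+1 => a <= b) phi ->
  nondecreasing implb (structure_level k).
Proof. by move=> phiP x y /phiP le_xy; apply/implyP => /leq_trans; apply. Qed.

Lemma bin_structure_nondecreasing (k : nat) :
  (forall i, 0 < m i) ->
  nondecreasing (fun a b : 'I_M.+1 => a <= b) phi ->
  nondecreasing implb (bin_structure k).
Proof.
move=> m_gt0 /(structure_level_nondecreasing k) phiP z w /forallP le_zw.
by apply/phiP/forallP => i; rewrite !val_top_shift // leq_add2l.
Qed.

End System.

(* Main.v *)
(** Inclusion-exclusion on the components that sit at their maximal state shows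
    that d(f) is the alternating sum, over sets A of components, of f at the
    state m - 1_A: the alternating sum over nonempty families of minimal path
    vectors lying below x is f(x) up to sign. That formula only sees f on the
    top cube m - 1 + {0,1}^n, where phi_k and psi_k agree. *)
Require Import Defs.
From mathcomp Require Import all_boot all_order all_algebra.

Import GRing.Theory.
Local Open Scope ring_scope.

(** The sum expands a product over the elements of [T]: an element of [Q] gives the factor
    [-1 + 1 = 0], any other element gives [0 + 1 = 1]. *)
Lemma sum_sign_subsets (T : finType) (Q : {set T}) :
  \sum_(A : {set T} | A \subset Q) (-1) ^+ #|A| = (Q == set0)%:Z.
Proof.
transitivity (\prod_(i : T) ((if i \in Q then -1 else 0) + 1 : int)).
  rewrite bigA_distr /= big_mkcond /=; apply: eq_bigr => A _.
  case: ifP => [sAQ | /negbT/subsetPn[i iA iQ]].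
    rewrite -big_mkcond /= -prodr_const; apply: eq_bigr => i iA.
    by rewrite (subsetP sAQ).
  by rewrite (bigD1 i) //= iA (negbTE iQ) mul0r.
have [-> | /set0Pn[i iQ]] := eqVneq Q set0.
  by rewrite big1 // => i _; rewrite inE add0r.
by rewrite (bigD1 i) //= iQ addNr mul0r.
Qed.

Section Domination.

Variables (n : nat) (m : 'I_n -> nat).
Implicit Types (x y : state m) (F : {set state m}).

Lemma set_max_val F i : set_max F i = \max_(x in F) x i :> nat.
Proof.
apply: (big_morph (fun x : state m => x i : nat)) => [x y|]; last by rewrite ffunE.
by rewrite ffunE Order.POrderTheory.maxEle leEord; case: leqP.
Qed.

(** This turns a bound on a maximum into a subset condition, the shape that [sum_sign_subsets] can
    sum over. *)
Lemma set_max_leP F y : state_le (set_max F) y = (F \subset [set x | state_le x y]).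
Proof.
apply/forallP/subsetP => [leF x xF | leF i].
  rewrite inE; apply/forallP => i; apply: leq_trans (leF i).
  by rewrite set_max_val (leq_bigmax_cond (F := fun x : state m => x i : nat)).
rewrite set_max_val; apply/bigmax_leqP => x /leF.
by rewrite inE => /forallP.
Qed.

Lemma state_le_refl x : state_le x x.
Proof. exact/forallP. Qed.

Lemma state_le_anti x y : state_le x y -> state_le y x -> x = y.
Proof.
move=> /forallP le_xy /forallP le_yx; apply/ffunP => i; apply/val_inj/eqP.
by rewrite eqn_leq le_xy le_yx.
Qed.

Lemma state_le_trans y x z : state_le x y -> state_le y z -> state_le x z.
Proof.
move=> /forallP le_xy /forallP le_yz; apply/forallP => i.
exact: leq_trans (le_xy i) (le_yz i).
Qed.

Lemma state_bot_le x : state_le (state_bot m) x.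
Proof. by apply/forallP => i; rewrite ffunE. Qed.

Lemma state_max_bot x : state_max x (state_bot m) = x.
Proof.
apply/ffunP => i; apply/val_inj; rewrite !ffunE Order.POrderTheory.maxEle leEord.
by case: leqP => //=; rewrite leqn0 => /eqP.
Qed.

Lemma max_closed_set_max (S : {set state m}) F :
  max_closed S -> F \subset S -> F != set0 -> set_max F \in S.
Proof.
move=> /forall_inP clS /subsetP sFS /set0Pn[x xF].
(* The fold starts at [state_bot], which may lie outside [S], so the invariant must allow that
   value. *)
have [maxE | //] : set_max F = state_bot m \/ set_max F \in S.
  rewrite /set_max; elim/big_rec: _ => [|y z /sFS yS [-> | zS]]; first by left.
    by rewrite state_max_bot; right.
  by right; exact: (forall_inP (clS y yS)).
(* If the maximum is [state_bot], every member of [F] is [state_bot], so the maximum is itself a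
   member. *)
suff -> : set_max F = x by exact: sFS.
have := state_le_refl (set_max F); rewrite set_max_leP => /subsetP/(_ _ xF).
rewrite inE maxE => x_le; exact/state_le_anti/x_le/state_bot_le.
Qed.

(** Odd formations count positively, whence the minus sign. The default 0 outside the closure is
    consistent: the maximum of a formation lies in every max-closed set containing the minimal
    paths, so no formation exists there. *)
Lemma signed_dominationE (f : state m -> bool) :
  signed_domination f =
  - \sum_(F in formations f (state_top m)) (-1) ^+ #|F|.
Proof.
rewrite /signed_domination /signed_domination_fun; case: ifPn => [_ | topN].
  rewrite (bigID (fun F : {set state m} => odd #|F|)) /= opprD.
  rewrite (eq_bigr (fun=> -1)) => [|F /andP[_ oddF]]; last first.
    by rewrite -signr_odd oddF.
  rewrite [X in _ - X](eq_bigr (fun=> 1)) => [|F /andP[_ evenF]]; last first.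
    by rewrite -signr_odd (negbTE evenF).
  rewrite sumrN opprK -!natz -!sum1_card.
  by rewrite !natr_sum; congr (_ - _); apply: eq_bigl => F; rewrite !inE.
rewrite big1 ?oppr0 // => F; rewrite inE => /and3P[F0 sFP /eqP maxF].
case/negP: topN; apply/bigcapP => S /andP[sPS clS].
by rewrite -maxF max_closed_set_max // (subset_trans sFP).
Qed.

Lemma exists_min_path (f : state m -> bool) x :
  f x -> exists2 y, min_path f y & state_le y x.
Proof.
move=> fx.
(* A state of least coordinate sum among those below [x] where [f] holds is a minimal path. *)
pose P y := f y && state_le y x; have Px : P x by rewrite /P fx state_le_refl.
case: (@arg_minnP _ x P (fun y : state m => \sum_i y i)%N Px) => y /andP[fy le_yx] minY.
exists y => //; rewrite /min_path fy /=.
apply/forallP => z; apply/implyP => /andP[le_zy neq_zy]; apply/negP => fz.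
have/minY : P z by rewrite /P fz (state_le_trans y).
have le_sum : (\sum_i z i <= \sum_i y i ?= iff [forall i, z i == y i :> nat])%N.
  by apply: leqif_sum => i _; split=> //; apply: (forallP le_zy).
rewrite leqNgt ltn_neqAle !le_sum andbT negbK => /forallP eq_zy.
case/eqP: neq_zy; apply/ffunP => i; exact/val_inj/eqP/eq_zy.
Qed.

(** The families summed over are the nonempty subsets of the set [Q] of minimal paths below [x].
    Removing the term 1 of the empty family from the full alternating sum leaves -1 if [Q] is
    nonempty, which means [f x], and 0 otherwise. *)
Lemma sum_sign_min_paths (f : state m -> bool) x :
  nondecreasing implb f ->
  \sum_(F : {set state m} |
      [&& F != set0, F \subset min_paths f & state_le (set_max F) x])
    (-1) ^+ #|F| = - (f x)%:Z.
Proof.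
move=> f_mono; pose Q := min_paths f :&: [set y | state_le y x].
have -> : f x = (Q != set0).
  apply/idP/set0Pn => [/exists_min_path[y miny le_yx] | [y]].
    by exists y; rewrite !inE miny.
  rewrite !inE => /andP[/andP[fy _]] /f_mono.
  by rewrite fy.
have := sum_sign_subsets _ Q; rewrite (bigD1 set0) ?sub0set //= cards0 expr0.
rewrite (eq_bigl (fun F : {set state m} =>
  [&& F != set0, F \subset min_paths f & state_le (set_max F) x])) => [|F].
  by move/(canRL (addKr _)) ->; case: (Q == set0).
by rewrite set_max_leP subsetI andbC.
Qed.

Definition lower_top (A : {set 'I_n}) : state m := [ffun i => inord (m i - (i \in A))].

Lemma lower_top_val A i : lower_top A i = (m i - (i \in A))%N :> nat.
Proof. by rewrite ffunE inordK // ltnS leq_subr. Qed.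

Hypothesis m_gt0 : forall i, (0 < m i)%N.

Lemma le_lower_top x A :
  state_le x (lower_top A) = (A \subset [set i | (x i < m i)%N]).
Proof.
apply/forallP/subsetP => [le_x i iA | sA i].
  by move: (le_x i); rewrite inE lower_top_val iA -ltnS subn1 prednK.
rewrite lower_top_val; case: (boolP (i \in A)) => [/sA | _]; last by rewrite subn0 -ltnS.
by rewrite inE subn1 -[(_ <= (m i).-1)%N]ltnS prednK.
Qed.

(** The sets [A] that occur are the subsets of the components where [x] is not maximal, and there is
    no such component exactly when [x] is the top state. *)
Lemma sum_sign_lower_top x :
  \sum_(A : {set 'I_n} | state_le x (lower_top A)) (-1) ^+ #|A|
  = (x == state_top m)%:Z.
Proof.
under eq_bigl do rewrite le_lower_top.
rewrite sum_sign_subsets; congr (Posz (nat_of_bool _)).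
apply/eqP/eqP => [/setP no_lt | ->]; last first.
  by apply/setP => i; rewrite !inE ffunE ltnn.
apply/ffunP => i; apply/val_inj/eqP; move: (no_lt i).
rewrite !inE ffunE => no_lt_i; rewrite eqn_leq leqNgt [(m i <= _)%N]leqNgt no_lt_i.
by rewrite -leqNgt -ltnS ltn_ord.
Qed.

Lemma signed_domination_lower_top (f : state m -> bool) :
  nondecreasing implb f ->
  signed_domination f = \sum_(A : {set 'I_n}) (-1) ^+ #|A| * (f (lower_top A))%:Z.
Proof.
move=> f_mono.
rewrite signed_dominationE.
under [RHS]eq_bigr => A _ do
  rewrite -[(f _)%:Z]opprK -sum_sign_min_paths // mulrN mulr_sumr.
rewrite sumrN; congr (- _).
(* After the exchange, the inner sum over [A] for a fixed family [F] is 1 or 0 according to whether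
   the maximum of [F] is the top state, so only the formations of the top survive. *)
rewrite (exchange_big_dep
  (fun F : {set state m} => (F != set0) && (F \subset min_paths f))) /=; last first.
  by move=> A F _ /and3P[-> ->].
rewrite (eq_bigl (fun F : {set state m} =>
  ((F != set0) && (F \subset min_paths f)) && (set_max F == state_top m)));
  last by move=> F; rewrite inE andbA.
rewrite big_mkcondr /=; apply: eq_bigr => F /andP[F0 sFP].
rewrite -mulr_suml F0 sFP /= sum_sign_lower_top.
by case: ifP; rewrite ?mul1r ?mul0r.
Qed.

End Domination.

Local Close Scope ring_scope.

Theorem theorem5p1 (n : nat) (m : 'I_n -> nat) (M : nat)
    (phi : state m -> 'I_M.+1) (k : nat)
    (m_ge1 : forall i : 'I_n, 1 <= m i)
    (phi_mono : nondecreasing (fun a b : 'I_M.+1 => a <= b) phi)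
    (k_range : 1 <= k <= M) :
  signed_domination (structure_level phi k) =
  signed_domination (bin_structure phi k).
Proof.
rewrite !signed_domination_lower_top //.
- apply: eq_bigr => A _; rewrite /bin_structure.
  (* On the top cube, [m - 1_A = (m - 1) + (1 - 1_A)], so both sums have the same terms. *)
  suff -> : lower_top n m A = top_shift m (lower_top n (fun=> 1) A) by [].
  apply/ffunP => i; apply/val_inj; rewrite /= val_top_shift // !lower_top_val.
  by case: (i \in A); rewrite ?subn0 ?addn0 ?subnK.
- exact: bin_structure_nondecreasing.
- exact: structure_level_nondecreasing.
Qed.
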